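(* (Burchnall's formula) Let $Q$ be a $C^\infty$ matrix valued function, $\nu\in\mathcal V$ and $n\in\mathbb{N}$. Then $$\Bigl(QS^{(\nu+n-1)}\cdots S^{(\nu+1)}S^{(\nu)}\Bigr)(x)=\sum_{k=0}^n\binom{n}{k}Q^{(k)}(x)\bigl(G_{n-k}^{(\nu+k)}\bigr)^{-1}P_{n-k}^{(\nu+k)}(x)\left(\Phi^{(\nu)}(x)\cdots\Phi^{(\nu+k-1)}(x)\right)^\ast .$$
   Context: General setting. $\mathcal V$ is a parameter set such that $\nu\in\mathcal V$ implies $\nu+1\in\mathcal V$. For each $\nu\in\mathcal V$, $W^{(\nu)}$ is an $N\times N$ matrix weight on an interval $[a,b]$ ($a,b$ possibly infinite): $W^{(\nu)}$ is Hermitian, positive definite almost everywhere, at least $C^2$ on $(a,b)$, and has finite moments of all orders. $^\ast$ is the conjugate transpose. $\{P_n^{(\nu)}\}_{n\ge0}$ are the monic matrix valued orthogonal polynomials (leading coefficient the identity) for $W^{(\nu)}$, i.e. $\int_a^bP_n^{(\nu)}(x)W^{(\nu)}(x)P_m^{(\nu)}(x)^\ast dx=0$ for $n\neq m$. Assumptions, for all $\nu\in\mathcal V$: (1) (Pearson equations) there are matrix valued polynomials $\Phi^{(\nu)}$, $\Psi^{(\nu)}$ of degree at most two and one respectively with $W^{(\nu+1)}(x)=W^{(\nu)}(x)\Phi^{(\nu)}(x)$ and $\frac{dW^{(\nu+1)}}{dx}(x)=W^{(\nu)}(x)\Psi^{(\nu)}(x)$ for all $x$; (2) (shift operators) with the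 operator $S^{(\nu)}$ acting from the right by $(QS^{(\nu)})(x)=\frac{dQ}{dx}(x)\Phi^{(\nu)}(x)^\ast+Q(x)\Psi^{(\nu)}(x)^\ast$, one has, for $n\ge1$, $\frac{dP_n^{(\nu)}}{dx}=nP_{n-1}^{(\nu+1)}$ and $P_{n-1}^{(\nu+1)}S^{(\nu)}=K_n^{(\nu)}P_n^{(\nu)}$ with $K_n^{(\nu)}$ a constant invertible matrix; (3) (Rodrigues formula) for every $n\in\mathbb{N}$, $P_n^{(\nu)}(x)=G_n^{(\nu)}\left(\frac{d^nW^{(\nu+n)}}{dx^n}(x)\right)\bigl(W^{(\nu)}(x)\bigr)^{-1}$, where $G_n^{(\nu)}=(K_n^{(\nu)})^{-1}(K_{n-1}^{(\nu+1)})^{-1}\cdots(K_1^{(\nu+n-1)})^{-1}$ (wherever $W^{(\nu)}(x)$ is invertible). In $QS^{(\nu+n-1)}\cdots S^{(\nu)}$ the operators are applied successively from left to right ($S^{(\nu+n-1)}$ first); $Q^{(k)}$ is the $k$-th derivative; empty products are the identity. *)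

(* Defs.v *)
From HB Require Import structures.
From mathcomp Require Import all_boot all_order all_algebra.
From mathcomp Require Import all_classical all_reals all_analysis.
From mathcomp Require Export complex.

Set Implicit Arguments.
Unset Strict Implicit.
Unset Printing Implicit Defensive.

Import Order.TTheory GRing.Theory Num.Theory.
Import numFieldNormedType.Exports.

Local Open Scope classical_set_scope.
Local Open Scope complex_scope.
Local Open Scope sesquilinear_scope.
Local Open Scope ring_scope.

(* The open interval (a, b), where a may be -oo and b may be +oo. *)
Definition ointerval (R : realType) (a b : \bar R) : set R :=
  [set x | (a < x%:E)%E /\ (x%:E < b)%E].

(* Functions of a real variable with values in complex matrices are            *)
(* differentiated entrywise, through real and imaginary parts: R[i] carries no *)
(* normed module structure over R.                                             *)
Definition mxderivable (R : realType) (m n : nat) (F : R -> 'M[R[i]]_(m, n))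
    (x : R) : Prop :=
  forall i j, derivable (fun y => complex.Re (F y i j)) x 1 /\
              derivable (fun y => complex.Im (F y i j)) x 1.

Definition mxcontinuous_at (R : realType) (m n : nat)
    (F : R -> 'M[R[i]]_(m, n)) (x : R) : Prop :=
  forall i j, {for x, continuous (fun y => complex.Re (F y i j))} /\
              {for x, continuous (fun y => complex.Im (F y i j))}.

Definition mxderive (R : realType) (m n : nat) (F : R -> 'M[R[i]]_(m, n))
    (x : R) : 'M[R[i]]_(m, n) :=
  \matrix_(i, j) (derive1 (fun y => complex.Re (F y i j)) x +i*
                  derive1 (fun y => complex.Im (F y i j)) x).

Definition mxderiven (R : realType) (m n k : nat)
    (F : R -> 'M[R[i]]_(m, n)) : R -> 'M[R[i]]_(m, n) :=
  iter k (@mxderive R m n) F.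

Definition is_Ck (R : realType) (m n k : nat) (D : set R)
    (F : R -> 'M[R[i]]_(m, n)) : Prop :=
  (forall j x, (j < k)%N -> D x -> mxderivable (mxderiven j F) x) /\
  (forall x, D x -> mxcontinuous_at (mxderiven k F) x).

Definition is_smooth (R : realType) (m n : nat) (D : set R)
    (F : R -> 'M[R[i]]_(m, n)) : Prop :=
  forall k, is_Ck k D F.

Definition mxintegral (R : realType) (m n : nat) (D : set R)
    (F : R -> 'M[R[i]]_(m, n)) : 'M[R[i]]_(m, n) :=
  \matrix_(i, j)
    ((\int[lebesgue_measure]_(x in D) complex.Re (F x i j)) +i*
     (\int[lebesgue_measure]_(x in D) complex.Im (F x i j))).

(* In R[i], 0 < z means that z is real and positive. *)
Definition posdefmx (R : realType) (n : nat) (M : 'M[R[i]]_n) : Prop :=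
  forall v : 'cV[R[i]]_n, v != 0 -> 0 < (v ^t* *m M *m v) 0 0.

Definition has_finite_moments (R : realType) (n : nat) (D : set R)
    (W : R -> 'M[R[i]]_n) : Prop :=
  forall (k : nat) i j,
    (@lebesgue_measure R).-integrable D
      (fun x => (x ^+ k * complex.Re (W x i j))%:E) /\
    (@lebesgue_measure R).-integrable D
      (fun x => (x ^+ k * complex.Im (W x i j))%:E).

(* Conditions on the weight are imposed on the open interval only: the weight  *)
(* may be undefined or singular at finite endpoints.                           *)
Definition is_mx_weight (R : realType) (n : nat) (a b : \bar R)
    (W : R -> 'M[R[i]]_n) : Prop :=
  [/\ forall x, ointerval a b x -> W x \is hermsymmx,
      {ae @lebesgue_measure R, forall x, ointerval a b x -> posdefmx (W x)},
      is_Ck 2 (ointerval a b) W &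
      has_finite_moments (ointerval a b) W].

(* Value at a real point of a polynomial with matrix coefficients; the scalar  *)
(* matrix x%:M is central, so left and right evaluation agree.                 *)
Definition mxpeval (R : realType) (N : nat) (p : {poly 'M[R[i]]_N.+1})
    (x : R) : 'M[R[i]]_N.+1 :=
  p.[(x%:C)%:M].

Definition is_monic_mvop (R : realType) (N : nat) (a b : \bar R)
    (W : R -> 'M[R[i]]_N.+1) (P : nat -> {poly 'M[R[i]]_N.+1}) : Prop :=
  (forall n, size (P n) = n.+1 /\ P n \is monic) /\
  (forall n m, n != m ->
     mxintegral (ointerval a b)
       (fun x => mxpeval (P n) x *m W x *m (mxpeval (P m) x) ^t*) = 0).

Definition shift_op (R : realType) (N : nat) (Phi Psi : {poly 'M[R[i]]_N.+1})
    (Q : R -> 'M[R[i]]_N.+1) : R -> 'M[R[i]]_N.+1 :=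
  fun x => mxderive Q x *m (mxpeval Phi x) ^t* + Q x *m (mxpeval Psi x) ^t*.

(* Q S^(nu+n-1) ... S^(nu+1) S^(nu): foldr applies the index n-1 first. *)
Definition iter_shift (R : realType) (N : nat) (T : pzSemiRingType)
    (Phi Psi : T -> {poly 'M[R[i]]_N.+1}) (nu : T) (n : nat)
    (Q : R -> 'M[R[i]]_N.+1) : R -> 'M[R[i]]_N.+1 :=
  foldr (fun k F => shift_op (Phi (nu + k%:R)) (Psi (nu + k%:R)) F)
        Q (iota 0 n).

(* (K_n^(nu))^-1 (K_(n-1)^(nu+1))^-1 ... (K_1^(nu+n-1))^-1, in this order. *)
Definition Gmx (R : realType) (N : nat) (T : pzSemiRingType)
    (K : T -> nat -> 'M[R[i]]_N.+1) (nu : T) (n : nat) : 'M[R[i]]_N.+1 :=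
  \prod_(i < n) (K (nu + i%:R) (n - i)%N)^-1.

(* Main.v *)
Require Import Defs.
From HB Require Import structures.
From mathcomp Require Import all_boot all_order all_algebra.
From mathcomp Require Import all_classical all_reals all_analysis.
From mathcomp Require Import ring.

(** Burchnall's formula follows by induction on n from two identities about a
single shift operator, the induction step applying the outermost operator
S^(nu) to the formula for (nu + 1, n).

Write A_m^(nu) for (G_m^(nu))^-1 P_m^(nu). The raising relation together with
G_(m+1)^(nu) = (K_(m+1)^(nu))^-1 G_m^(nu+1) says that S^(nu) maps A_m^(nu+1) to
A_(m+1)^(nu) ([shift_op_Rodrigues_fun]).

The other identity moves a factor Phi^(nu+1)^* through the operator:
(H Phi^(nu+1)^* ) S^(nu) = (H S^(nu+1)) Phi^(nu)^* ([shift_op_exchange]).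
It amounts to the relation
Phi^(nu) (Phi^(nu+1))' + Psi^(nu) Phi^(nu+1) = Phi^(nu) Psi^(nu+1),
which results from computing the derivative of W^(nu+2) = W^(nu+1) Phi^(nu+1)
in two ways by the Pearson equations and cancelling W^(nu)
([pearson_compat]). The cancellation is legitimate almost everywhere, hence on
a dense subset of (a, b), and the relation extends to (a, b) by continuity.
Iterating the exchange along the product Phi^(nu+1) ... Phi^(nu+k) gives
[shift_op_Phi_prod].

Since (q F) S = q' F Phi^* + q (F S), the operator S^(nu) sends the k-th term
of the formula for (nu + 1, n) to the sum of the terms of indices k + 1 and k
for (nu, n + 1), and Pascal's rule ([sum_binS]) recombines them. The argument
takes place at the level of the shift operators, so the formula holds at every
point of (a, b), including those where a weight is singular. *)

Set Implicit Arguments.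
Unset Strict Implicit.
Unset Printing Implicit Defensive.

Import Order.TTheory GRing.Theory Num.Theory.
Import numFieldNormedType.Exports.

Local Open Scope classical_set_scope.
Local Open Scope complex_scope.
Local Open Scope sesquilinear_scope.
Local Open Scope ring_scope.

(** * Derivatives of complex and matrix valued functions *)

(** The derivative is a relation, in the style of [is_derive], so that the rules
below deliver differentiability and the value of the derivative together. *)
Definition has_cderive (R : realType) (f : R -> R[i]) (x : R) (l : R[i]) :=
  is_derive x 1 (fun y => complex.Re (f y)) (complex.Re l) /\
  is_derive x 1 (fun y => complex.Im (f y)) (complex.Im l).

Lemma has_cderive_cst (R : realType) (c : R[i]) (x : R) :
  has_cderive (fun=> c) x 0.
Proof. by split; apply: is_derive_cst. Qed.

Lemma has_cderiveD (R : realType) (f g : R -> R[i]) (x : R) (l m : R[i]) :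
  has_cderive f x l -> has_cderive g x m ->
  has_cderive (fun y => f y + g y) x (l + m).
Proof.
move=> [fr fi] [gr gi]; split.
  rewrite raddfD /=; apply: near_eq_is_derive (is_deriveD fr gr).
  by near=> y; rewrite raddfD.
rewrite raddfD /=; apply: near_eq_is_derive (is_deriveD fi gi).
by near=> y; rewrite raddfD.
Unshelve. all: by end_near. Qed.

Lemma ReM (R : realType) (z w : R[i]) : complex.Re (z * w) =
  complex.Re z * complex.Re w - complex.Im z * complex.Im w.
Proof. by case: z w => [? ?] [? ?]. Qed.

Lemma ImM (R : realType) (z w : R[i]) : complex.Im (z * w) =
  complex.Re z * complex.Im w + complex.Im z * complex.Re w.
Proof. by case: z w => [? ?] [? ?]. Qed.

Lemma has_cderiveM (R : realType) (f g : R -> R[i]) (x : R) (l m : R[i]) :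
  has_cderive f x l -> has_cderive g x m ->
  has_cderive (fun y => f y * g y) x (l * g x + f x * m).
Proof.
move=> [fr fi] [gr gi]; split.
  have := is_deriveB (is_deriveM fr gr) (is_deriveM fi gi).
  set d := (X in is_derive _ _ _ X) => h.
  have -> : complex.Re (l * g x + f x * m) = d.
    by rewrite /d raddfD /= !ReM /GRing.scale /=; ring.
  by apply: near_eq_is_derive h; near=> y; rewrite ReM.
have := is_deriveD (is_deriveM fr gi) (is_deriveM fi gr).
set d := (X in is_derive _ _ _ X) => h.
have -> : complex.Im (l * g x + f x * m) = d.
  by rewrite /d raddfD /= !ImM /GRing.scale /=; ring.
by apply: near_eq_is_derive h; near=> y; rewrite ImM.
Unshelve. all: by end_near. Qed.

Lemma has_cderive_conj (R : realType) (f : R -> R[i]) (x : R) (l : R[i]) :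
  has_cderive f x l ->
  has_cderive (fun y => Num.conj (f y)) x (Num.conj l).
Proof.
move=> [fr fi]; split.
  have -> : complex.Re (Num.conj l) = complex.Re l by case: l {fr fi}.
  by apply: near_eq_is_derive fr; near=> y; case: (f y).
have -> : complex.Im (Num.conj l) = - complex.Im l by case: l {fr fi}.
by apply: near_eq_is_derive (is_deriveN fi); near=> y; rewrite fctE; case: (f y).
Unshelve. all: by end_near. Qed.

Lemma has_cderive_sum (R : realType) (n : nat) (f : 'I_n -> R -> R[i])
    (x : R) (l : 'I_n -> R[i]) :
  (forall k, has_cderive (f k) x (l k)) ->
  has_cderive (fun y => \sum_k f k y) x (\sum_k l k).
Proof.
elim: n f l => [|n IH] f l h.
  have -> : (fun y => \sum_k f k y) = fun=> 0.
    by apply: funext => y; rewrite big_ord0.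
  by rewrite big_ord0; apply: has_cderive_cst.
have -> : (fun y => \sum_k f k y) =
    fun y => f ord0 y + \sum_k f (lift ord0 k) y.
  by apply: funext => y; rewrite big_ord_recl.
by rewrite big_ord_recl; apply: has_cderiveD (h _) (IH _ _ _).
Qed.

Lemma has_cderive_continuous (R : realType) (f : R -> R[i]) (x : R) (l : R[i]) :
  has_cderive f x l ->
  {for x, continuous (fun y => complex.Re (f y))} /\
  {for x, continuous (fun y => complex.Im (f y))}.
Proof.
by move=> [[fr _] [fi _]]; split; apply: differentiable_continuous;
  apply/derivable1_diffP.
Qed.

Definition has_mxderive (R : realType) (m n : nat) (F : R -> 'M[R[i]]_(m, n))
    (x : R) (D : 'M[R[i]]_(m, n)) :=
  forall i j, has_cderive (fun y => F y i j) x (D i j).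

Lemma has_mxderiveE (R : realType) (m n : nat) (F : R -> 'M[R[i]]_(m, n))
    (x : R) (D : 'M[R[i]]_(m, n)) :
  has_mxderive F x D -> mxderive F x = D.
Proof.
move=> h; apply/matrixP => i j; rewrite mxE !derive1E.
have [h1 h2] := h i j.
by rewrite (@derive_val _ _ _ _ _ _ _ h1) (@derive_val _ _ _ _ _ _ _ h2); case: (D i j).
Qed.

Lemma mxderivableP (R : realType) (m n : nat) (F : R -> 'M[R[i]]_(m, n))
    (x : R) :
  mxderivable F x -> has_mxderive F x (mxderive F x).
Proof.
move=> h i j; rewrite mxE; have [h1 h2] := h i j.
by split; rewrite /= derive1E; apply: derivableP.
Qed.

Lemma has_mxderive_near (R : realType) (m n : nat)
    (F G : R -> 'M[R[i]]_(m, n)) (x : R) (D : 'M[R[i]]_(m, n)) :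
  (\near x, F x = G x) -> has_mxderive F x D -> has_mxderive G x D.
Proof.
move=> FG h i j; have [h1 h2] := h i j.
by split; [apply: near_eq_is_derive h1|apply: near_eq_is_derive h2];
  apply: filterS FG => y ->.
Qed.

Lemma has_mxderive_cst (R : realType) (m n : nat) (A : 'M[R[i]]_(m, n))
    (x : R) :
  has_mxderive (fun=> A) x 0.
Proof. by move=> i j; rewrite mxE; apply: has_cderive_cst. Qed.

Lemma has_mxderiveD (R : realType) (m n : nat) (F G : R -> 'M[R[i]]_(m, n))
    (x : R) (D E : 'M[R[i]]_(m, n)) :
  has_mxderive F x D -> has_mxderive G x E ->
  has_mxderive (fun y => F y + G y) x (D + E).
Proof.
move=> hF hG i j; rewrite mxE; under eq_fun do rewrite mxE.
exact: has_cderiveD (hF i j) (hG i j).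
Qed.

Lemma has_mxderiveM (R : realType) (m n p : nat) (F : R -> 'M[R[i]]_(m, n))
    (G : R -> 'M[R[i]]_(n, p)) (x : R) (D : 'M[R[i]]_(m, n))
    (E : 'M[R[i]]_(n, p)) :
  has_mxderive F x D -> has_mxderive G x E ->
  has_mxderive (fun y => F y *m G y) x (D *m G x + F x *m E).
Proof.
move=> hF hG i j; rewrite !mxE -big_split /=; under eq_fun do rewrite mxE.
by apply: has_cderive_sum => k; apply: has_cderiveM.
Qed.

Lemma has_mxderive_trmxC (R : realType) (m n : nat) (F : R -> 'M[R[i]]_(m, n))
    (x : R) (D : 'M[R[i]]_(m, n)) :
  has_mxderive F x D -> has_mxderive (fun y => (F y) ^t*) x (D ^t*).
Proof.
move=> hF i j; rewrite !mxE; under eq_fun do rewrite !mxE.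
exact: has_cderive_conj.
Qed.

Lemma has_mxderive_sum (R : realType) (m n p : nat)
    (F : 'I_p -> R -> 'M[R[i]]_(m, n)) (x : R) (D : 'I_p -> 'M[R[i]]_(m, n)) :
  (forall k, has_mxderive (F k) x (D k)) ->
  has_mxderive (fun y => \sum_k F k y) x (\sum_k D k).
Proof.
move=> h i j; rewrite summxE; under eq_fun do rewrite summxE.
by apply: has_cderive_sum => k; apply: h.
Qed.

Lemma has_mxderive_muln (R : realType) (m n k : nat)
    (F : R -> 'M[R[i]]_(m, n)) (x : R) (D : 'M[R[i]]_(m, n)) :
  has_mxderive F x D -> has_mxderive (fun y => F y *+ k) x (D *+ k).
Proof.
move=> h; rewrite -[k]card_ord -sumr_const.
under eq_fun do rewrite -sumr_const.
exact: has_mxderive_sum.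
Qed.

Lemma has_mxderive_scalar (R : realType) (N : nat) (x : R) :
  has_mxderive (fun y : R => (y%:C)%:M : 'M[R[i]]_N) x 1%:M.
Proof.
move=> i j; rewrite mxE; under eq_fun do rewrite mxE.
case: (i == j) => /=; last exact: has_cderive_cst.
by split; [apply: is_derive_id | apply: is_derive_cst].
Qed.

Lemma has_mxderive_mxpeval (R : realType) (N : nat)
    (p : {poly 'M[R[i]]_N.+1}) (x : R) :
  has_mxderive (mxpeval p) x (mxpeval p^`() x).
Proof.
elim/poly_ind: p => [|p c IH].
  rewrite deriv0; have -> : mxpeval 0 = (fun=> 0) :> (R -> 'M[R[i]]_N.+1).
    by apply: funext => y; rewrite /mxpeval horner0.
  exact: has_mxderive_cst.
have -> : mxpeval (p * 'X + c%:P) =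
    (fun y : R => mxpeval p y *m (y%:C)%:M + c).
  by apply: funext => y; rewrite /mxpeval hornerMXaddC.
have -> : mxpeval (p * 'X + c%:P)^`() x =
    mxpeval p^`() x *m (x%:C)%:M + mxpeval p x *m 1%:M + 0.
  by rewrite derivMXaddC /mxpeval hornerD hornerMX mulmx1 addr0 addrC.
apply: (has_mxderiveD _ (has_mxderive_cst _ _)).
exact: has_mxderiveM IH (has_mxderive_scalar _).
Qed.

(** * Density of full-measure sets, and polynomial evaluation *)

(** A negligible set cannot contain a ball, whose measure is positive. *)
Lemma ae_nbhs_ex (R : realType) (S : set R) (x : R) (U : set R) :
  {ae @lebesgue_measure R, forall y, S y} -> nbhs x U ->
  exists y, U y /\ S y.
Proof.
move=> aeS /nbhs_ballP [e /= e0 eU]; apply: contrapT => noUS.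
have : (@lebesgue_measure R).-negligible (ball x e).
  by apply: negligibleS aeS => y /eU Uy Sy; apply: noUS; exists y.
have mB : measurable (ball x e : set R).
  by apply: measurable_realfun.measurable_ball.
move/(@negligibleP _ _ _ (@lebesgue_measure R) _ mB) => ball0.
have /eqP := etrans (esym (lebesgue_measure_ball x (ltW e0))) ball0.
by rewrite eqe mulrn_eq0 (gt_eqF e0).
Qed.

Lemma mx_eq0_dense (R : realType) (m n : nat) (F : R -> 'M[R[i]]_(m, n))
    (x : R) :
  mxcontinuous_at F x ->
  (forall U, nbhs x U -> exists y, U y /\ F y = 0) -> F x = 0.
Proof.
move=> cF dense; apply/matrixP => i j; have [cRe cIm] := cF i j; rewrite mxE.
suff zero (g : R -> R) : {for x, continuous g} ->
    (forall y, F y = 0 -> g y = 0) -> g x = 0.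
  apply/eqP; rewrite eq_complex; apply/andP; split; apply/eqP.
    by rewrite (zero _ cRe) // => y ->; rewrite mxE.
  by rewrite (zero _ cIm) // => y ->; rewrite mxE.
move=> cg g0; apply/eqP/negPn/negP => gx.
have [y [gy /g0/eqP]] := dense _ (cvgr_neq0 _ cg gx).
by rewrite (negPf gy).
Qed.

(** A singular M has a nonzero v with M v = 0, so the form of M vanishes at v. *)
Lemma posdefmx_unit (R : realType) (n : nat) (M : 'M[R[i]]_n) :
  posdefmx M -> M \in unitmx.
Proof.
move=> pM; rewrite -unitmx_tr -row_free_unit -kermx_eq0 -nz_row_eq0.
apply/negPn/negP => u0; set u := nz_row _ in u0.
have Mu : M *m u^T = 0.
  apply: trmx_inj; rewrite trmx_mul trmxK trmx0.
  by apply/sub_kermxP; apply: nz_row_sub.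
have := pM u^T; rewrite trmx_eq0 => /(_ u0).
by rewrite -mulmxA Mu mulmx0 mxE ltxx.
Qed.

Lemma ointerval_nbhs (R : realType) (a b : \bar R) (x : R) :
  ointerval a b x -> nbhs x (ointerval a b).
Proof.
move=> [ax xb]; apply: filterI.
  exact: open_nbhs_nbhs (conj (@open_ereal_gt _ a) ax).
exact: open_nbhs_nbhs (conj (@open_ereal_lt _ b) xb).
Qed.

Lemma trmxC_mul (R : realType) (m n p : nat) (A : 'M[R[i]]_(m, n))
    (B : 'M[R[i]]_(n, p)) :
  (A *m B) ^t* = B ^t* *m A ^t*.
Proof. by rewrite trmx_mul map_mxM. Qed.

Lemma trmxCD (R : realType) (m n : nat) (A B : 'M[R[i]]_(m, n)) :
  (A + B) ^t* = A ^t* + B ^t*.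
Proof. by apply/matrixP => i j; rewrite !mxE rmorphD. Qed.

Lemma mxpevalD (R : realType) (N : nat) (p q : {poly 'M[R[i]]_N.+1}) x :
  mxpeval (p + q) x = mxpeval p x + mxpeval q x.
Proof. by rewrite /mxpeval hornerD. Qed.

Lemma mxpevalN (R : realType) (N : nat) (p : {poly 'M[R[i]]_N.+1}) x :
  mxpeval (- p) x = - mxpeval p x.
Proof. by rewrite /mxpeval hornerN. Qed.

(** Over the noncommutative ring of matrices, evaluation is multiplicative here
because the point x%:M is central. *)
Lemma mxpevalM (R : realType) (N : nat) (p q : {poly 'M[R[i]]_N.+1}) x :
  mxpeval (p * q) x = mxpeval p x *m mxpeval q x.
Proof.
rewrite /mxpeval hornerM_comm; [by []|exact: esym (scalar_mxC _ _)].
Qed.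

(** * Compatibility of consecutive Pearson equations *)

(** Both sides become the derivative of W2 = W1 Phi1, with W1 Phi1^`() and
W1' Phi1 expressed through W0, after multiplication by W0 on the left. Where
W0 is invertible this forces equality, and such points are dense. *)
Lemma pearson_compat (R : realType) (N : nat) (a b : \bar R)
    (W0 W1 W2 : R -> 'M[R[i]]_N.+1)
    (Phi0 Psi0 Phi1 Psi1 : {poly 'M[R[i]]_N.+1}) :
  {ae @lebesgue_measure R, forall x, ointerval a b x -> posdefmx (W0 x)} ->
  (forall x, ointerval a b x -> mxderivable W1 x) ->
  (forall x, ointerval a b x -> W1 x = W0 x *m mxpeval Phi0 x) ->
  (forall x, ointerval a b x -> mxderive W1 x = W0 x *m mxpeval Psi0 x) ->
  (forall x, ointerval a b x -> W2 x = W1 x *m mxpeval Phi1 x) ->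
  (forall x, ointerval a b x -> mxderive W2 x = W1 x *m mxpeval Psi1 x) ->
  forall x, ointerval a b x ->
  mxpeval Phi0 x *m mxpeval Phi1^`() x + mxpeval Psi0 x *m mxpeval Phi1 x =
  mxpeval Phi0 x *m mxpeval Psi1 x.
Proof.
move=> posW0 dW1 W1E dW1E W2E dW2E x Ix.
(* The difference of the two sides is a polynomial, hence continuous. *)
pose p := Phi0 * Phi1^`() + Psi0 * Phi1 - Phi0 * Psi1.
suff : mxpeval p x = 0.
  by rewrite /p mxpevalD mxpevalN mxpevalD !mxpevalM => /subr0_eq.
apply: mx_eq0_dense => [i j|U Ux].
  exact: has_cderive_continuous (has_mxderive_mxpeval p x i j).
have [y [[Uy Iy] posy]] :=
  ae_nbhs_ex posW0 (filterI Ux (ointerval_nbhs Ix)).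
exists y; split=> //; have W0y := posdefmx_unit (posy Iy).
have dW2 : mxderive W2 y =
    mxderive W1 y *m mxpeval Phi1 y + W1 y *m mxpeval Phi1^`() y.
  apply/has_mxderiveE; apply: (@has_mxderive_near _ _ _
    (fun z => W1 z *m mxpeval Phi1 z)).
    by apply: filterS (ointerval_nbhs Iy) => z Iz; rewrite W2E.
  exact: has_mxderiveM (mxderivableP (dW1 _ Iy)) (has_mxderive_mxpeval _ _).
move: dW2; rewrite dW2E // dW1E // W1E // => eqW.
suff pW0 : W0 y *m mxpeval p y = 0 by rewrite -[LHS](mulKmx W0y) pW0 mulmx0.
rewrite /p mxpevalD mxpevalN mxpevalD !mxpevalM mulmxBr mulmxDr !mulmxA eqW.
by apply/eqP; rewrite subr_eq0 addrC.
Qed.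

(** * Calculus of shift operators *)

Lemma shift_opE (R : realType) (N : nat) (Phi Psi : {poly 'M[R[i]]_N.+1})
    (F : R -> 'M[R[i]]_N.+1) (x : R) (D : 'M[R[i]]_N.+1) :
  has_mxderive F x D ->
  shift_op Phi Psi F x =
  D *m (mxpeval Phi x) ^t* + F x *m (mxpeval Psi x) ^t*.
Proof. by rewrite /shift_op => /has_mxderiveE ->. Qed.

Lemma shift_op_near (R : realType) (N : nat) (Phi Psi : {poly 'M[R[i]]_N.+1})
    (F G : R -> 'M[R[i]]_N.+1) (x : R) (D : 'M[R[i]]_N.+1) :
  (\near x, F x = G x) -> has_mxderive G x D ->
  shift_op Phi Psi F x = shift_op Phi Psi G x.
Proof.
move=> FG dG.
have dF : has_mxderive F x D.
  by apply: has_mxderive_near dG; apply: filterS FG => y ->.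
by rewrite (shift_opE _ _ dF) (shift_opE _ _ dG) (nbhs_singleton FG).
Qed.

(** A left factor only contributes through the derivative term of the operator,
which acts from the right. *)
Lemma shift_opMl (R : realType) (N : nat) (Phi Psi : {poly 'M[R[i]]_N.+1})
    (q F : R -> 'M[R[i]]_N.+1) (x : R) (dq dF : 'M[R[i]]_N.+1) :
  has_mxderive q x dq -> has_mxderive F x dF ->
  shift_op Phi Psi (fun y => q y *m F y) x =
  dq *m F x *m (mxpeval Phi x) ^t* + q x *m shift_op Phi Psi F x.
Proof.
move=> hq hF; rewrite (shift_opE _ _ (has_mxderiveM hq hF)) (shift_opE _ _ hF).
by rewrite mulmxDl mulmxDr !mulmxA addrA.
Qed.

(** Expanding both sides, the coefficient of dH is (Phi0 Phi1)^* on each, and the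
coefficient of H is the adjoint of a side of the compatibility relation. *)
Lemma shift_op_exchange (R : realType) (N : nat)
    (Phi0 Psi0 Phi1 Psi1 : {poly 'M[R[i]]_N.+1})
    (H : R -> 'M[R[i]]_N.+1) (x : R) (dH : 'M[R[i]]_N.+1) :
  mxpeval Phi0 x *m mxpeval Phi1^`() x + mxpeval Psi0 x *m mxpeval Phi1 x =
    mxpeval Phi0 x *m mxpeval Psi1 x ->
  has_mxderive H x dH ->
  shift_op Phi0 Psi0 (fun y => H y *m (mxpeval Phi1 y) ^t*) x =
  shift_op Phi1 Psi1 H x *m (mxpeval Phi0 x) ^t*.
Proof.
move=> compat hH.
have hPhi1 := has_mxderive_trmxC (has_mxderive_mxpeval Phi1 x).
rewrite (shift_opE _ _ (has_mxderiveM hH hPhi1)) (shift_opE _ _ hH).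
rewrite !mulmxDl -!mulmxA -!trmxC_mul -addrA -mulmxDr -compat.
by rewrite trmxCD.
Qed.

Definition Phi_prod (R : realType) (N : nat) (T : pzSemiRingType)
    (Phi : T -> {poly 'M[R[i]]_N.+1}) (nu : T) (k : nat) (x : R) :=
  (\prod_(i < k) mxpeval (Phi (nu + i%:R)) x) ^t*.

(** By the Rodrigues formula, this is the n-th derivative of W^(nu+n) times the
inverse of W^(nu), wherever the latter exists. *)
Definition Rodrigues_fun (R : realType) (N : nat) (T : pzSemiRingType)
    (K : T -> nat -> 'M[R[i]]_N.+1) (P : T -> nat -> {poly 'M[R[i]]_N.+1})
    (nu : T) (n : nat) (x : R) :=
  invmx (Gmx K nu n) *m mxpeval (P nu n) x.

Lemma addr_natS (T : pzSemiRingType) (nu : T) (k : nat) :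
  nu + k.+1%:R = nu + 1 + k%:R.
Proof. by rewrite -addn1 natrD addrAC addrA. Qed.

Lemma Phi_prod0 (R : realType) (N : nat) (T : pzSemiRingType)
    (Phi : T -> {poly 'M[R[i]]_N.+1}) (nu : T) (x : R) :
  Phi_prod Phi nu 0 x = 1%:M.
Proof. by rewrite /Phi_prod big_ord0 trmx1 map_mx1. Qed.

Lemma Phi_prodS (R : realType) (N : nat) (T : pzSemiRingType)
    (Phi : T -> {poly 'M[R[i]]_N.+1}) (nu : T) (k : nat) (x : R) :
  Phi_prod Phi nu k.+1 x =
  Phi_prod Phi (nu + 1) k x *m (mxpeval (Phi nu) x) ^t*.
Proof.
rewrite /Phi_prod big_ord_recl addr0 -trmxC_mul; congr (_ ^t*).
by congr (_ *m _); apply: eq_bigr => i _; rewrite /= addr_natS.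
Qed.

Lemma ex_has_mxderive_Phi_prod (R : realType) (N : nat) (T : pzSemiRingType)
    (Phi : T -> {poly 'M[R[i]]_N.+1}) (nu : T) (k : nat) (x : R) :
  exists D, has_mxderive (Phi_prod Phi nu k) x D.
Proof.
elim: k nu => [|k IH] nu.
  exists 0; have -> : Phi_prod Phi nu 0 = fun=> 1%:M.
    by apply: funext => y; rewrite Phi_prod0.
  exact: has_mxderive_cst.
have [D hD] := IH (nu + 1).
have -> : Phi_prod Phi nu k.+1 =
    fun y => Phi_prod Phi (nu + 1) k y *m (mxpeval (Phi nu) y) ^t*.
  by apply: funext => y; rewrite Phi_prodS.
eexists; apply: has_mxderiveM hD _.
exact: has_mxderive_trmxC (has_mxderive_mxpeval _ _).
Qed.

(** Each exchange removes the factor Phi^(nu+1)^* on the right, leaves Phi^(nu)^*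
there and raises the parameter of the operator by one. *)
Lemma shift_op_Phi_prod (R : realType) (N : nat) (T : pzSemiRingType)
    (V : set T) (Phi Psi : T -> {poly 'M[R[i]]_N.+1}) (x : R)
    (hV : forall nu, V nu -> V (nu + 1))
    (compat : forall nu, V nu ->
      mxpeval (Phi nu) x *m mxpeval (Phi (nu + 1))^`() x +
        mxpeval (Psi nu) x *m mxpeval (Phi (nu + 1)) x =
      mxpeval (Phi nu) x *m mxpeval (Psi (nu + 1)) x)
    (F : R -> 'M[R[i]]_N.+1) (dF : 'M[R[i]]_N.+1)
    (hF : has_mxderive F x dF) (k : nat) (nu : T) :
  V nu ->
  shift_op (Phi nu) (Psi nu) (fun y => F y *m Phi_prod Phi (nu + 1) k y) x =
  shift_op (Phi (nu + k%:R)) (Psi (nu + k%:R)) F x *m Phi_prod Phi nu k x.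
Proof.
elim: k nu => [|k IH] nu Vnu.
  rewrite addr0 Phi_prod0 mulmx1; congr (shift_op _ _ _ x).
  by apply: funext => y; rewrite Phi_prod0 mulmx1.
have -> : (fun y => F y *m Phi_prod Phi (nu + 1) k.+1 y) =
    fun y => F y *m Phi_prod Phi (nu + 1 + 1) k y
               *m (mxpeval (Phi (nu + 1)) y) ^t*.
  by apply: funext => y; rewrite Phi_prodS mulmxA.
have [D hD] := ex_has_mxderive_Phi_prod Phi (nu + 1 + 1) k x.
rewrite (shift_op_exchange (compat _ Vnu) (has_mxderiveM hF hD)).
by rewrite (IH _ (hV _ Vnu)) addr_natS Phi_prodS mulmxA.
Qed.

Lemma GmxS (R : realType) (N : nat) (T : pzSemiRingType)
    (K : T -> nat -> 'M[R[i]]_N.+1) (nu : T) (n : nat) :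
  Gmx K nu n.+1 = invmx (K nu n.+1) *m Gmx K (nu + 1) n.
Proof.
rewrite /Gmx big_ord_recl addr0 subn0; congr (_ *m _).
by apply: eq_bigr => i _; rewrite /= addr_natS.
Qed.

Lemma Gmx_unit (R : realType) (N : nat) (T : pzSemiRingType) (V : set T)
    (K : T -> nat -> 'M[R[i]]_N.+1)
    (hV : forall nu, V nu -> V (nu + 1))
    (hK : forall nu n, V nu -> (1 <= n)%N -> K nu n \in unitmx)
    (n : nat) (nu : T) :
  V nu -> Gmx K nu n \in unitmx.
Proof.
elim: n nu => [|n IH] nu Vnu; first by rewrite /Gmx big_ord0 unitmx1.
by rewrite GmxS unitmx_mul unitmx_inv hK //= IH //; apply: hV.
Qed.

Lemma invmx_Gmx (R : realType) (N : nat) (T : pzSemiRingType) (V : set T)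
    (K : T -> nat -> 'M[R[i]]_N.+1)
    (hV : forall nu, V nu -> V (nu + 1))
    (hK : forall nu n, V nu -> (1 <= n)%N -> K nu n \in unitmx)
    (n : nat) (nu : T) :
  V nu -> invmx (Gmx K nu n.+1) = invmx (Gmx K (nu + 1) n) *m K nu n.+1.
Proof.
move=> Vnu; rewrite GmxS -[X in _ = _ *m X]invmxK.
apply: (@invrM 'M[R[i]]_N.+1).
  by rewrite unitmx_inv; apply: hK.
exact: (Gmx_unit hV hK _ (hV _ Vnu)).
Qed.

(** The factor K of the raising relation is absorbed by the recursion of the
matrices G, so no constant remains. *)
Lemma shift_op_Rodrigues_fun (R : realType) (N : nat) (T : pzSemiRingType)
    (V : set T) (P : T -> nat -> {poly 'M[R[i]]_N.+1})
    (Phi Psi : T -> {poly 'M[R[i]]_N.+1}) (K : T -> nat -> 'M[R[i]]_N.+1)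
    (hV : forall nu, V nu -> V (nu + 1))
    (hraise : forall nu n x, V nu -> (1 <= n)%N ->
       shift_op (Phi nu) (Psi nu) (mxpeval (P (nu + 1) n.-1)) x =
       K nu n *m mxpeval (P nu n) x)
    (hK : forall nu n, V nu -> (1 <= n)%N -> K nu n \in unitmx)
    (nu : T) (n : nat) (x : R) :
  V nu ->
  shift_op (Phi nu) (Psi nu) (Rodrigues_fun K P (nu + 1) n) x =
  Rodrigues_fun K P nu n.+1 x.
Proof.
move=> Vnu; rewrite (shift_opMl _ _ (has_mxderive_cst _ _)
  (has_mxderive_mxpeval _ _)) !mul0mx add0r (hraise _ n.+1) //.
by rewrite /Rodrigues_fun (invmx_Gmx hV hK) // mulmxA.
Qed.

Lemma iter_shiftS (R : realType) (N : nat) (T : pzSemiRingType)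
    (Phi Psi : T -> {poly 'M[R[i]]_N.+1}) (nu : T) (n : nat)
    (Q : R -> 'M[R[i]]_N.+1) :
  iter_shift Phi Psi nu n.+1 Q =
  shift_op (Phi nu) (Psi nu) (iter_shift Phi Psi (nu + 1) n Q).
Proof.
rewrite /iter_shift /= addr0 (iotaDl 1 0) foldr_map; congr shift_op.
by elim: (iota 0 n) => //= k s ->; rewrite -addr_natS.
Qed.

Lemma sum_binS (A : nmodType) (n : nat) (t : nat -> A) :
  \sum_(k < n.+2) t k *+ 'C(n.+1, k) =
  \sum_(k < n.+1) (t k.+1 + t k) *+ 'C(n, k).
Proof.
under [RHS]eq_bigr do rewrite mulrnDl.
rewrite big_split /= big_ord_recl bin0.
have -> : \sum_(k < n.+1) t (lift ord0 k) *+ 'C(n.+1, lift ord0 k) =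
    \sum_(k < n.+1) (t k.+1 *+ 'C(n, k.+1) + t k.+1 *+ 'C(n, k)).
  by apply: eq_bigr => k _; rewrite lift0 binS mulrnDr.
rewrite big_split /= addrA [RHS]addrC; congr (_ + _).
rewrite [RHS]big_ord_recl bin0; congr (_ + _).
rewrite big_ord_recr /= bin_small // mulr0n addr0.
by apply: eq_bigr.
Qed.

Lemma mulmxMnl (R : realType) (N : nat) (A B : 'M[R[i]]_N.+1) (k : nat) :
  (A *+ k) *m B = (A *m B) *+ k.
Proof. exact: (@mulrnAl 'M[R[i]]_N.+1). Qed.

Lemma shift_op_sum (R : realType) (N : nat) (Phi Psi : {poly 'M[R[i]]_N.+1})
    (n : nat) (F : 'I_n -> R -> 'M[R[i]]_N.+1) (c : 'I_n -> nat) (x : R)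
    (dF : 'I_n -> 'M[R[i]]_N.+1) :
  (forall k, has_mxderive (F k) x (dF k)) ->
  shift_op Phi Psi (fun y => \sum_k F k y *+ c k) x =
  \sum_k shift_op Phi Psi (F k) x *+ c k.
Proof.
move=> hF.
have hS : has_mxderive (fun y => \sum_k F k y *+ c k) x (\sum_k dF k *+ c k).
  by apply: has_mxderive_sum => k; apply: has_mxderive_muln (hF k).
rewrite (shift_opE _ _ hS) !mulmx_suml -big_split /=.
by apply: eq_bigr => k _; rewrite (shift_opE _ _ (hF k)) !mulmxMnl -mulrnDl.
Qed.

Lemma addr_nat_closed (T : pzSemiRingType) (V : set T) (nu : T) (k : nat) :
  (forall mu, V mu -> V (mu + 1)) -> V nu -> V (nu + k%:R).
Proof.
move=> hV Vnu; elim: k => [|k IH]; first by rewrite addr0.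
by rewrite addr_natS addrAC; apply: hV.
Qed.

(** * Burchnall's formula *)

Lemma has_mxderive_Rodrigues_fun (R : realType) (N : nat) (T : pzSemiRingType)
    (K : T -> nat -> 'M[R[i]]_N.+1) (P : T -> nat -> {poly 'M[R[i]]_N.+1})
    (nu : T) (n : nat) (x : R) :
  has_mxderive (Rodrigues_fun K P nu n) x
    (Rodrigues_fun K (fun mu m => (P mu m)^`()) nu n x).
Proof.
rewrite /Rodrigues_fun -[X in has_mxderive _ _ X]add0r.
rewrite -[X in X + _](mul0mx _ (mxpeval (P nu n) x)).
exact: has_mxderiveM (has_mxderive_cst _ _) (has_mxderive_mxpeval _ _).
Qed.

(** The compatibility relation encodes all that the induction uses of the weights
and of their Pearson equations. *)
Lemma Burchnall_formula (R : realType) (N : nat) (T : pzSemiRingType)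
    (V : set T) (D : set R)
    (P : T -> nat -> {poly 'M[R[i]]_N.+1})
    (Phi Psi : T -> {poly 'M[R[i]]_N.+1}) (K : T -> nat -> 'M[R[i]]_N.+1)
    (nbhsD : forall x, D x -> nbhs x D)
    (hV : forall nu, V nu -> V (nu + 1))
    (P0 : forall nu, V nu -> P nu 0%N = 1)
    (compat : forall nu x, V nu -> D x ->
      mxpeval (Phi nu) x *m mxpeval (Phi (nu + 1))^`() x +
        mxpeval (Psi nu) x *m mxpeval (Phi (nu + 1)) x =
      mxpeval (Phi nu) x *m mxpeval (Psi (nu + 1)) x)
    (hraise : forall nu n x, V nu -> (1 <= n)%N ->
       shift_op (Phi nu) (Psi nu) (mxpeval (P (nu + 1) n.-1)) x =
       K nu n *m mxpeval (P nu n) x)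
    (hK : forall nu n, V nu -> (1 <= n)%N -> K nu n \in unitmx)
    (Q : R -> 'M[R[i]]_N.+1) (hQ : is_smooth D Q) (n : nat) (nu : T) (x : R) :
  V nu -> D x ->
  iter_shift Phi Psi nu n Q x =
  \sum_(k < n.+1)
    (mxderiven k Q x *m Rodrigues_fun K P (nu + k%:R) (n - k)%N x
       *m Phi_prod Phi nu k x) *+ 'C(n, k).
Proof.
elim: n nu x => [|n IH] nu x Vnu Dx.
  rewrite big_ord1 bin0 Phi_prod0 mulmx1 addr0 /Rodrigues_fun /Gmx big_ord0.
  by rewrite invmx1 mul1mx P0 // /mxpeval hornerC mulmx1.
have dQ k : has_mxderive (mxderiven k Q) x (mxderiven k.+1 Q x).
  by apply: mxderivableP; have [+ _] := hQ k.+1; apply.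
have dA mu m := has_mxderive_Rodrigues_fun K P mu m x.
(* The terms of the formula for (nu + 1, n), bracketed with the derivative of Q
   as a left factor, ready for shift_opMl. *)
pose F (k : 'I_n.+1) y := mxderiven k Q y *m
  (Rodrigues_fun K P (nu + 1 + k%:R) (n - k)%N y *m Phi_prod Phi (nu + 1) k y).
have /choice [dF hF] : forall k, exists E, has_mxderive (F k) x E.
  move=> k.
  have [dB hB] := ex_has_mxderive_Phi_prod Phi (nu + 1) k x.
  by eexists; rewrite /F; apply: has_mxderiveM (dQ k) (has_mxderiveM (dA _ _) hB).
rewrite iter_shiftS.
(* The operator differentiates, so the induction hypothesis is needed on a
   neighbourhood of x. *)
have IHF : \near x,
    iter_shift Phi Psi (nu + 1) n Q x = \sum_k F k x *+ 'C(n, k).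
  apply: filterS (nbhsD _ Dx) => y Dy; rewrite (IH _ _ (hV _ Vnu) Dy).
  by apply: eq_bigr => k _; congr (_ *+ _); exact/esym/mulmxA.
have dS : has_mxderive (fun y => \sum_k F k y *+ 'C(n, k)) x
    (\sum_k dF k *+ 'C(n, k)).
  by apply: has_mxderive_sum => k; apply: has_mxderive_muln (hF k).
rewrite (shift_op_near _ _ IHF dS).
rewrite (@shift_op_sum _ _ _ _ _ F (fun k => 'C(n, k)) _ _ hF).
pose t k := mxderiven k Q x *m Rodrigues_fun K P (nu + k%:R) (n.+1 - k)%N x
  *m Phi_prod Phi nu k x.
rewrite (sum_binS n t); apply: eq_bigr => k _; congr (_ *+ _).
have [dB hB] := ex_has_mxderive_Phi_prod Phi (nu + 1) k x.
rewrite (shift_opMl _ _ (dQ k) (has_mxderiveM (dA _ _) hB)).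
rewrite (shift_op_Phi_prod hV (fun mu Vmu => compat mu x Vmu Dx) (dA _ _)) //.
congr (_ + _).
  by rewrite /t subSS Phi_prodS addr_natS !mulmxA.
rewrite addrAC (shift_op_Rodrigues_fun hV hraise hK); last first.
  exact: addr_nat_closed.
have kn : (k <= n)%N by rewrite -ltnS.
by rewrite /t (subSn kn) [LHS]mulmxA.
Qed.

Theorem theorem4p1 (R : realType) (N : nat) (T : pzSemiRingType) (V : set T)
    (a b : \bar R)
    (W : T -> R -> 'M[R[i]]_N.+1)
    (P : T -> nat -> {poly 'M[R[i]]_N.+1})
    (Phi Psi : T -> {poly 'M[R[i]]_N.+1})
    (K : T -> nat -> 'M[R[i]]_N.+1)
    (hab : (a < b)%E)
    (hV : forall nu, V nu -> V (nu + 1))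
    (hW : forall nu, V nu -> is_mx_weight a b (W nu))
    (hP : forall nu, V nu -> is_monic_mvop a b (W nu) (P nu))
    (hPhi : forall nu, V nu -> (size (Phi nu) <= 3)%N)
    (hPsi : forall nu, V nu -> (size (Psi nu) <= 2)%N)
    (hPearson1 : forall nu x, V nu -> ointerval a b x ->
       W (nu + 1) x = W nu x *m mxpeval (Phi nu) x)
    (hPearson2 : forall nu x, V nu -> ointerval a b x ->
       mxderive (W (nu + 1)) x = W nu x *m mxpeval (Psi nu) x)
    (hlower : forall nu n x, V nu -> (1 <= n)%N ->
       mxderive (mxpeval (P nu n)) x = mxpeval (P (nu + 1) n.-1) x *+ n)
    (hraise : forall nu n x, V nu -> (1 <= n)%N ->
       shift_op (Phi nu) (Psi nu) (mxpeval (P (nu + 1) n.-1)) x =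
       K nu n *m mxpeval (P nu n) x)
    (hK : forall nu n, V nu -> (1 <= n)%N -> K nu n \in unitmx)
    (hRodrigues : forall nu n x, V nu -> ointerval a b x ->
       W nu x \in unitmx ->
       mxpeval (P nu n) x =
       Gmx K nu n *m mxderiven n (W (nu + n%:R)) x *m invmx (W nu x))
    (Q : R -> 'M[R[i]]_N.+1)
    (hQ : is_smooth (ointerval a b) Q)
    (nu : T) (hnu : V nu) (n : nat) (x : R) (hx : ointerval a b x) :
  iter_shift Phi Psi nu n Q x =
  \sum_(k < n.+1)
    (mxderiven k Q x *m invmx (Gmx K (nu + k%:R) (n - k)%N)
       *m mxpeval (P (nu + k%:R) (n - k)%N) x
       *m (\prod_(i < k) mxpeval (Phi (nu + i%:R)) x) ^t*) *+ 'C(n, k).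
Proof.
have P0 mu : V mu -> P mu 0%N = 1.
  move=> /hP [/(_ 0%N) [sizeP monP] _].
  have Pc : P mu 0%N = ((P mu 0%N)`_0)%:P by apply: size1_polyC; rewrite sizeP.
  by move: monP; rewrite Pc monicE lead_coefC => /eqP ->.
have compat mu y : V mu -> ointerval a b y ->
    mxpeval (Phi mu) y *m mxpeval (Phi (mu + 1))^`() y +
      mxpeval (Psi mu) y *m mxpeval (Phi (mu + 1)) y =
    mxpeval (Phi mu) y *m mxpeval (Psi (mu + 1)) y.
  move=> Vmu; have Vmu1 := hV _ Vmu.
  have [_ posW _ _] := hW _ Vmu; have [_ _ [dW _] _] := hW _ Vmu1.
  apply: (pearson_compat posW (W1 := W (mu + 1)) (W2 := W (mu + 1 + 1))).
  - by move=> z; apply: (dW 0%N).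
  - by move=> z; apply: hPearson1.
  - by move=> z; apply: hPearson2.
  - by move=> z; apply: hPearson1.
  - by move=> z; apply: hPearson2.
rewrite (Burchnall_formula (@ointerval_nbhs _ a b) hV P0 compat hraise hK hQ n hnu hx).
by apply: eq_bigr => k _; congr (_ *m _ *+ _); apply: mulmxA.
Qed.
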